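(* Let $N$, $l$ and $m$ be positive integers such that $l\le N-1$ and $1\le m\le N$. Let $B_1,\ldots,B_N$ be independent identically distributed random variables with $\mathrm{Prob}(B_n=1)=\frac{m}{N}$ and $\mathrm{Prob}(B_n=0)=1-\frac{m}{N}$, and let $$\widetilde{U}_l(m,N)=\sum_{n=1}^N\cos\left(\frac{2nl\pi}{N}\right)B_n,\qquad \widetilde{V}_l(m,N)=-\sum_{n=1}^N\sin\left(\frac{2nl\pi}{N}\right)B_n.$$ Then $$\Vert \widetilde{U}_l(m,N)\Vert_{\psi_2}\le \frac{\sqrt{N}\left(\sqrt{2e}+\sqrt{2e+4}\right)}{4}\quad\text{and}\quad \Vert \widetilde{V}_l(m,N)\Vert_{\psi_2}\le \frac{\sqrt{N}\left(\sqrt{2e}+\sqrt{2e+4}\right)}{4}.$$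
   Context: For a sub-Gaussian real-valued random variable $X$ (in particular, for any bounded one), the sub-Gaussian norm is $\Vert X\Vert_{\psi_2}=\inf\left\{K>0:\ \mathbb{E}\left[\exp\left(\frac{X^2}{K^2}\right)\right]\le 2\right\}$. *)

(* Defs.v *)
From HB Require Import structures.
From mathcomp Require Import all_boot all_order all_algebra.
From mathcomp Require Import all_classical all_reals all_analysis.

Set Implicit Arguments.
Unset Strict Implicit.
Unset Printing Implicit Defensive.

Import Order.TTheory GRing.Theory Num.Theory.

Local Open Scope classical_set_scope.
Local Open Scope ring_scope.

(* The infimum is taken in the extended reals, so that the norm of a random
   variable that is not sub-Gaussian is +oo (the infimum of the empty set),
   whereas the real-valued [inf] would return the junk value 0. *)
Definition psi2_norm d (T : measurableType d) (R : realType)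
    (P : probability T R) (X : T -> R) : \bar R :=
  ereal_inf [set K%:E | K in
    [set K : R | 0 < K /\
       ('E_P[fun w => expR (X w ^+ 2 / K ^+ 2)] <= 2%:E)%E]].

Definition mutually_independent d (T : measurableType d) (R : realType)
    (P : probability T R) (I : finType) (X : I -> {RV P >-> R}) : Prop :=
  forall (J : {set I}) (A : I -> set R),
    (forall i, measurable (A i)) ->
    P (\bigcap_(i in [set` J]) (X i @^-1` A i)) =
    (\prod_(i in J) P (X i @^-1` A i))%E.

Definition identically_distributed d (T : measurableType d) (R : realType)
    (P : probability T R) (I : finType) (X : I -> {RV P >-> R}) : Prop :=
  forall (i j : I) (A : set R), measurable A ->
    distribution P (X i) A = distribution P (X j) A.

(* The index n : 'I_N ranges over 0, ..., N-1: [B n] is the variable written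
   B_(n+1) when the numbering starts at 1, hence the [n.+1] in the angle. *)
Definition Utilde d (T : measurableType d) (R : realType)
    (P : probability T R) (N : nat) (B : 'I_N -> {RV P >-> R}) (l : nat)
    : T -> R :=
  fun w => \sum_(n < N) cos (2 * n.+1%:R * l%:R * pi / N%:R) * B n w.

Definition Vtilde d (T : measurableType d) (R : realType)
    (P : probability T R) (N : nat) (B : 'I_N -> {RV P >-> R}) (l : nat)
    : T -> R :=
  fun w => - \sum_(n < N) sin (2 * n.+1%:R * l%:R * pi / N%:R) * B n w.

(* Main.v *)
(* Since the cosines (and the sines) sum to 0, the B_n may be centered, so both
   sums are centered sums of independent variables c_n (B_n - p) with
   |c_n| <= 1. Each term has moment generating function at most exp(s^2 / 4),
   hence the sum X satisfies E[exp(t X)] <= exp(t^2 N / 4). Averaging over a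
   standard Gaussian t, suitably scaled, gives E[exp(X^2 / K^2)] <= 2 as soon as
   K^2 >= 4N/3, and the constant of the statement satisfies this because e >= 2. *)
Require Import Defs.
From HB Require Import structures.
From mathcomp Require Import all_boot all_order all_algebra.
From mathcomp Require Import all_classical all_reals all_analysis.
From mathcomp Require Import measurable_realfun ring lra.

Set Implicit Arguments.
Unset Strict Implicit.
Unset Printing Implicit Defensive.

Import Order.TTheory GRing.Theory Num.Theory.

Local Open Scope classical_set_scope.
Local Open Scope ring_scope.

(** * Moment generating function of a centered Bernoulli variable *)

(** The quotient [g] of the two sides is nonincreasing on the nonnegative reals and [g 0 = 1]: its
    derivative has the sign of [h], which vanishes at 0 and has derivative
    [- (x * (expR x - expR (- x)))], at most 0 there. *)
Lemma cosh_le_expR (R : realType) (u : R) :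
  (expR u + expR (- u)) / 2 <= expR (u ^+ 2 / 2).
Proof.
wlog u0 : u / 0 <= u.
  move=> H; have [/H//|/ltW u0] := leP 0 u.
  by have := H (- u); rewrite oppr_ge0 opprK sqrrN addrC; apply.
pose g x : R := (expR x + expR (- x)) / 2 * expR (- (x ^+ 2 / 2)).
pose h x : R := (expR x - expR (- x)) - x * (expR x + expR (- x)).
have dh (x : R) : is_derive x 1 h (- (x * (expR x - expR (- x)))).
  by apply: is_derive_eq; rewrite /GRing.scale/=; ring.
have dg (x : R) : is_derive x 1 g (h x / 2 * expR (- (x ^+ 2 / 2))).
  by apply: is_derive_eq; rewrite /GRing.scale/= /h; field.
have decr (f df : R -> R) : (forall x : R, is_derive x 1 f (df x)) ->
    (forall x, 0 <= x -> df x <= 0) -> forall x, 0 <= x -> f x <= f 0.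
  move=> fd df0 x x0; apply: (@ler0_derive1_le_cc _ f 0 x).
  - by move=> y _; case: (fd y).
  - by move=> y /[!in_itv]/= /andP[/ltW y0 _]; rewrite derive1E (@derive_val _ _ _ _ _ _ _ (fd y)) df0.
  - apply: derivable_within_continuous => y _.
    by case: (fd y).
  - by rewrite in_itv/= x0 lexx.
  - by rewrite in_itv/= lexx.
  - by [].
have h0 x : 0 <= x -> h x <= 0.
  move=> x0; have -> : 0 = h 0 by rewrite /h oppr0; ring.
  apply: (decr _ _ dh) => // y y0; rewrite oppr_le0 mulr_ge0// subr_ge0.
  by rewrite ler_expR; lra.
have : g u <= g 0.
  apply: (decr _ _ dg) => // y y0.
  by rewrite mulr_le0_ge0 ?expR_ge0// pmulr_lle0 ?invr_gt0 ?h0.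
have -> : g 0 = 1 by rewrite /g oppr0 expr0n mul0r oppr0 expR0; field.
by rewrite /g (expRN (_ / 2)) ler_pdivrMr ?expR_gt0// mul1r.
Qed.

(* Symmetrization: by Jensen, multiplying by [E'], the moment generating function
   of an independent copy at [- s], can only increase the left-hand side. *)
Lemma bernoulli_mgf_le (R : realType) (p s : R) : 0 <= p <= 1 ->
  p * expR (s * (1 - p)) + (1 - p) * expR (s * (0 - p)) <= expR (s ^+ 2 / 4).
Proof.
move=> /andP[p0 p1].
set E := leLHS; set E' := p * expR (- (s * (1 - p))) + (1 - p) * expR (s * p).
(* Averaging [1 + x <= expR x] with weights [p] and [1 - p] cancels the linear terms. *)
have E'1 : 1 <= E'.
  have := expR_ge1Dx (- (s * (1 - p))); have := expR_ge1Dx (s * p).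
  rewrite /E'; nra.
have E0 : 0 <= E by rewrite addr_ge0// mulr_ge0 ?expR_ge0// subr_ge0.
have EE' : E * E' = 1 - 2 * (p * (1 - p)) + p * (1 - p) * (expR s + expR (- s)).
  have es : expR (- (s * (1 - p))) = (expR (s * (1 - p)))^-1 by rewrite expRN.
  have ep : expR (s * (0 - p)) = (expR (s * p))^-1.
    by rewrite sub0r mulrN expRN.
  have e : expR s = expR (s * (1 - p)) * expR (s * p).
    by rewrite -expRD; congr expR; ring.
  rewrite /E /E' es ep expRN e; field.
  by rewrite !expR_eq0.
apply: (@le_trans _ _ (E * E')); first by rewrite ler_peMr.
have es2 : expR s = expR (s / 2) ^+ 2 by rewrite -expRM_natl; congr expR; field.
have c2 : ((expR (s / 2) + expR (- (s / 2))) / 2) ^+ 2 <= expR (s ^+ 2 / 4).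
  have -> : s ^+ 2 / 4 = 2%:R * ((s / 2) ^+ 2 / 2) by field.
  rewrite expRM_natl ler_sqr ?nnegrE ?expR_ge0 ?cosh_le_expR//.
apply: le_trans c2; rewrite EE' !expRN es2.
have e0 := expR_gt0 (s / 2); set e := expR (s / 2) in e0 *.
have -> : e ^- 2 = (e^-1) ^+ 2 by rewrite exprVn.
have ee : e * e^-1 = 1 by rewrite divff ?gt_eqF.
(* The left side is [1 + p * (1 - p) * (e - e^-1) ^+ 2]. The second square gives
   [p * (1 - p) <= 1 / 4], and [1 + (e - e^-1) ^+ 2 / 4] is the square of [(e + e^-1) / 2]. *)
have := sqr_ge0 (e - e^-1); have := sqr_ge0 (p - (1 - p)).
nra.
Qed.

(** * From a moment generating function to a square-exponential moment *)

(** Completing the square: [u * y - y ^+ 2 / 2 = u ^+ 2 / 2 - (y - u) ^+ 2 / 2]. *)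
Lemma normal_pdf_tilt (R : realType) (u y : R) :
  expR (u * y) * normal_pdf 0 1 y = expR (u ^+ 2 / 2) * normal_pdf u 1 y.
Proof.
rewrite !normal_pdfE ?oner_neq0// /normal_fun mulrCA [RHS]mulrCA.
by congr (_ * _); rewrite -!expRD; congr expR; field.
Qed.

Lemma integral_expR_normal_pdf (R : realType) (u : R) :
  (\int[lebesgue_measure]_y (expR (u * y) * normal_pdf 0 1 y)%:E =
   (expR (u ^+ 2 / 2))%:E)%E.
Proof.
under eq_integral do rewrite normal_pdf_tilt EFinM.
rewrite ge0_integralZl_EFin ?expR_ge0//.
- by rewrite integral_normal_pdf mule1.
- by move=> y _; rewrite lee_fin normal_pdf_ge0.
- by apply/measurable_EFinP; exact: measurable_normal_pdf.
Qed.

(** [3 / 8 - 1 / 2 = - 1 / 8] is the coefficient of [y ^+ 2] for standard deviation 2, whose peak is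
    half as high. The total mass 2 on the right is the bound in the definition of the norm. *)
Lemma expR_normal_pdf_le (R : realType) (c y : R) : c <= 3 / 8 ->
  expR (c * y ^+ 2) * normal_pdf 0 1 y <= 2 * normal_pdf 0 2 y.
Proof.
move=> c38; rewrite !normal_pdfE ?oner_neq0 ?pnatr_eq0// /normal_fun.
have -> : normal_peak 1 = 2 * normal_peak 2 :> R.
  rewrite /normal_peak -!mulrnAr !(sqrtrM _ (sqr_ge0 _)) !sqrtr_sqr !ger0_norm//.
  by rewrite mul1r invfM mulrA divff ?pnatr_eq0// mul1r.
rewrite [leRHS]mulrA [leLHS]mulrCA ler_wpM2l ?mulr_ge0 ?normal_peak_ge0//.
rewrite -expRD ler_expR subr0.
have := sqr_ge0 y; nra.
Qed.

(* Writing [expR (u ^+ 2 / 2)] as a Gaussian average of [expR (u * y)] reduces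
   the bound to one on the moment generating function. *)
Lemma weighted_expR_sqr_le2 (R : realType) (S : finType) (q x : S -> R)
    (v K : R) : (forall s, 0 <= q s) ->
  (forall t, \sum_s q s * expR (t * x s) <= expR (t ^+ 2 * v / 2)) ->
  0 < K -> 8 / 3 * v <= K ^+ 2 ->
  \sum_s q s * expR (x s ^+ 2 / K ^+ 2) <= 2.
Proof.
move=> q0 mgf K0 vK.
have s2 : Num.sqrt 2 ^+ 2 = 2 :> R by rewrite sqr_sqrtr.
pose u s : R := Num.sqrt 2 * x s / K.
have uE s : x s ^+ 2 / K ^+ 2 = u s ^+ 2 / 2.
  by rewrite /u !exprMn s2 exprVn; field; rewrite gt_eqF.
rewrite -lee_fin -sumEFin.
pose f s (y : R) : R := q s * (expR (u s * y) * normal_pdf 0 1 y).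
have f0 s y : 0 <= f s y by rewrite !mulr_ge0 ?expR_ge0 ?normal_pdf_ge0.
have mphi (s : R) : measurable_fun setT (normal_pdf 0 s : R -> R).
  exact: measurable_normal_pdf.
have mexp s : measurable_fun setT (fun y => expR (u s * y) * normal_pdf 0 1 y).
  by apply: measurable_funM => //; exact: measurableT_comp.
have mf s : measurable_fun setT (f s) by exact: measurable_funM.
have m2phi : measurable_fun setT (fun y : R => 2 * normal_pdf 0 2 y).
  exact: measurable_funM.
rewrite (eq_bigr (fun s => \int[lebesgue_measure]_y (f s y)%:E)%E); last first.
  move=> s _; rewrite uE EFinM -integral_expR_normal_pdf -ge0_integralZl_EFin//.
  - by move=> y _; rewrite lee_fin mulr_ge0 ?expR_ge0 ?normal_pdf_ge0.
  - by apply/measurable_EFinP; exact: mexp.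
rewrite -ge0_integral_sum//; last 2 first.
  by move=> s; apply/measurable_EFinP; exact: mf.
  by move=> s y _; rewrite lee_fin.
have -> : 2%:E = (\int[lebesgue_measure]_y (2 * normal_pdf 0 2 y)%:E)%E :> \bar R.
  under eq_integral do rewrite EFinM.
  rewrite ge0_integralZl_EFin ?integral_normal_pdf ?mule1//.
  - by move=> y _; rewrite lee_fin normal_pdf_ge0.
  - by apply/measurable_EFinP; exact: mphi.
apply: ge0_le_integral => //.
- by move=> y _; apply: sume_ge0 => s _; rewrite lee_fin.
- by apply: emeasurable_sum => s; apply/measurable_EFinP; exact: mf.
- by apply/measurable_EFinP; exact: m2phi.
move=> y _; rewrite sumEFin lee_fin.
have c38 : v / K ^+ 2 <= 3 / 8.
  by rewrite ler_pdivrMr ?exprn_gt0//; lra.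
apply: le_trans (expR_normal_pdf_le y c38).
rewrite /f; under eq_bigr do rewrite mulrA.
rewrite -mulr_suml ler_wpM2r ?normal_pdf_ge0//.
(* For fixed [y], this choice of [t] satisfies [t * x s = u s * y], so the weighted sum is at most
   [expR (v / K ^+ 2 * y ^+ 2)]. *)
have := mgf (Num.sqrt 2 / K * y).
have -> : (Num.sqrt 2 / K * y) ^+ 2 * v / 2 = v / K ^+ 2 * y ^+ 2.
  by rewrite !exprMn s2 exprVn; field; rewrite gt_eqF.
have uyE s : Num.sqrt 2 / K * y * x s = u s * y by rewrite /u; ring.
by under eq_bigr do rewrite uyE.
Qed.

(** * Weighted sums of independent Bernoulli variables *)

(** The disjoint events [A b] fix the values of all [B i]. These are 0 or 1 only almost surely, so
    [g] is known only on the union [D] of the [A b], whose complement is shown to be null. *)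
Lemma independent_bernoulli_expectation d (T : measurableType d)
    (R : realType) (P : probability T R) (I : finType)
    (B : I -> {RV P >-> R}) (q : I -> bool -> R) (g : T -> R)
    (v : {ffun I -> bool} -> R) :
  mutually_independent B ->
  (forall i, q i true + q i false = 1) ->
  (forall i (b : bool), P [set w | B i w = b%:R] = (q i b)%:E) ->
  measurable_fun setT g -> (forall w, 0 <= g w) ->
  (forall w (b : {ffun I -> bool}), (forall i, B i w = (b i)%:R) -> g w = v b) ->
  ('E_P[g] = (\sum_(b : {ffun I -> bool}) (\prod_i q i (b i)) * v b)%R%:E)%E.
Proof.
move=> indep q1 law mg g0 gv.
pose A (b : {ffun I -> bool}) : set T :=
  \bigcap_(i in [set` [set: I]%SET]) (B i @^-1` [set (b i)%:R]).
have AP b w : A b w <-> forall i, B i w = (b i)%:R.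
  by split=> [Abw i|h i _]; [apply: Abw; rewrite /= inE|exact: h].
have mA b : measurable (A b).
  apply: fin_bigcap_measurable; first exact: finite_finset.
  by move=> i _; rewrite -[X in measurable X]setTI; exact: measurable_funP.
have PA b : P (A b) = (\prod_i q i (b i))%:E.
  rewrite /A indep; last by move=> i; exact: measurable_set1.
  rewrite -prodEFin; apply: eq_big => [i|i _]; first by rewrite inE.
  exact: law.
have tA : trivIset setT A.
  move=> b b' _ _ [w [/AP wb /AP wb']]; apply/ffunP => i.
  move: (wb i); rewrite wb' => /eqP; rewrite eqr_nat.
  by case: (b i); case: (b' i).
pose D := \big[setU/set0]_(b <- index_enum {ffun I -> bool}) A b.
have mD : measurable D by apply: bigsetU_measurable => b _.
have us := index_enum_uniq {ffun I -> bool}.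
have tAs : trivIset [set` index_enum {ffun I -> bool}] A.
  exact: sub_trivIset tA.
have PD : P D = 1%E.
  rewrite -[LHS]mul1e -integral_cst// ge0_integral_bigsetU//=.
  rewrite (eq_bigr (fun b : {ffun I -> bool} => (\prod_i q i (b i))%:E)); last first.
    by move=> b _; rewrite integral_cst// mul1e; exact: PA.
  (* The sum of the products factors into the product of the [q i true + q i false], each equal to
     1. *)
  rewrite sumEFin -(bigA_distr_bigA q) big1// => i _.
  by rewrite big_bool/= q1.
have PDC : P (~` D) = 0%E by rewrite probability_setC// PD subee.
have mge : measurable_fun setT (EFin \o g) by exact/measurable_EFinP.
rewrite unlock (ge0_negligible_integral (measurableC mD) _ _ _ PDC)//; last first.
  by move=> w _; rewrite lee_fin.
rewrite setTD setCK ge0_integral_bigsetU//; last 2 first.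
  exact: measurable_funS mge.
  by move=> w _; rewrite lee_fin.
rewrite -sumEFin; apply: eq_bigr => b _.
rewrite (eq_integral (cst (v b)%:E)); last first.
  by move=> w; rewrite inE => /AP/gv ->.
by rewrite integral_cst// muleC EFinM; congr (_ * _)%E; exact: PA.
Qed.

Lemma psi2_norm_bernoulli_sum_le d (T : measurableType d)
    (R : realType) (P : probability T R) (N : nat)
    (B : 'I_N -> {RV P >-> R}) (p K : R) (c : 'I_N -> R) :
  mutually_independent B -> 0 <= p <= 1 ->
  (forall n, P [set w | B n w = 1] = p%:E) ->
  (forall n, P [set w | B n w = 0] = (1 - p)%:E) ->
  (forall n, `|c n| <= 1) -> \sum_n c n = 0 ->
  0 < K -> 4 / 3 * N%:R <= K ^+ 2 ->
  (psi2_norm P (fun w => (\sum_n c n * B n w)%R) <= K%:E)%E.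
Proof.
move=> indep p01 B1 B0 c1 c0 K0 NK.
apply: ereal_inf_lbound; exists K => //; split => //.
pose q (n : 'I_N) (b : bool) : R := if b then p else 1 - p.
pose x (b : {ffun 'I_N -> bool}) : R := \sum_n c n * (b n)%:R.
have q0 n b : 0 <= q n b by case/andP: p01 => ? ?; rewrite /q; case: b; lra.
rewrite (@independent_bernoulli_expectation _ _ _ _ _ B q _
  (fun b => expR (x b ^+ 2 / K ^+ 2)))//; first last.
- by move=> w b wb; rewrite /x; under eq_bigr do rewrite wb.
- apply: measurableT_comp => //; apply: measurable_funM => //.
  apply: measurable_funX; apply: measurable_sum => n.
  exact: measurable_funM.
- by move=> n [].
- by move=> n; rewrite /q addrC subrK.
rewrite lee_fin.
(* The [N] factors [expR (t ^+ 2 / 4)] multiply to [expR (t ^+ 2 * v / 2)] for this [v], and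
   [8 / 3 * v = 4 / 3 * N%:R]. *)
apply: (weighted_expR_sqr_le2 (v := N%:R / 2)) => //; last by lra.
  by move=> b; apply: prodr_ge0.
move=> t.
(* Centering is free because the coefficients sum to 0. *)
have xE b : t * x b = \sum_n t * c n * ((b n)%:R - p).
  under eq_bigr do rewrite mulrBr.
  rewrite sumrB -mulr_suml -mulr_sumr c0 mulr0 mul0r subr0 /x mulr_sumr.
  by apply: eq_bigr => n _; rewrite mulrA.
under eq_bigr do rewrite xE expR_sum -big_split/=.
rewrite -(bigA_distr_bigA (fun n b => q n b * expR (t * c n * (b%:R - p)))).
have -> : t ^+ 2 * (N%:R / 2) / 2 = \sum_(n < N) t ^+ 2 / 4.
  by rewrite sumr_const card_ord -mulr_natr; field.
rewrite expR_sum; apply: ler_prod => n _.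
rewrite big_bool/=; apply/andP; split.
  case/andP: p01 => p0 p1; apply: addr_ge0;
    by rewrite mulr_ge0 ?expR_ge0 ?subr_ge0.
apply: le_trans (bernoulli_mgf_le _ p01) _.
rewrite ler_expR ler_wpM2r// exprMn ler_piMr ?sqr_ge0//.
by rewrite -real_normK ?num_real// expr_le1.
Qed.

(** * Vanishing trigonometric sums *)

(* Multiplying by the nonzero number [2 * sin (x / 2)] makes both sums telescope. *)
Lemma sum_cos_sin_eq0 (R : realType) (N : nat) (x : R) : sin (x / 2) != 0 ->
  cos (N%:R * x + x / 2) = cos (x / 2) ->
  sin (N%:R * x + x / 2) = sin (x / 2) ->
  \sum_(n < N) cos (n.+1%:R * x) = 0 /\ \sum_(n < N) sin (n.+1%:R * x) = 0.
Proof.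
move=> s0 hc hs.
(* The lower endpoint of each term is the upper endpoint of the preceding one. *)
have shift (n : nat) : n.+1%:R * x - x / 2 = n%:R * x + x / 2.
  by rewrite -natr1; field.
split; apply: (mulfI (mulf_neq0 _ s0)) (_ : 2 * _ * _ = _);
  rewrite ?pnatr_eq0// mulr0 mulr_sumr.
- rewrite (eq_bigr (fun n : 'I_N => sin (n.+1%:R * x + x / 2) -
      sin (n%:R * x + x / 2))); last first.
    by move=> n _; rewrite -(shift n) sinD sinB; ring.
  rewrite -(big_mkord xpredT (fun n => sin (n.+1%:R * x + x / 2) -
      sin (n%:R * x + x / 2))) telescope_sumr//.
  by rewrite hs mul0r add0r subrr.
- rewrite (eq_bigr (fun n : 'I_N => - (cos (n.+1%:R * x + x / 2) -
      cos (n%:R * x + x / 2)))); last first.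
    by move=> n _; rewrite -(shift n) cosD cosB; ring.
  rewrite sumrN -(big_mkord xpredT (fun n => cos (n.+1%:R * x + x / 2) -
      cos (n%:R * x + x / 2))) telescope_sumr//.
  by rewrite hc mul0r add0r subrr oppr0.
Qed.

(** Real and imaginary parts of the sum of the first [N] powers of an [N]-th root of unity other
    than 1. *)
Lemma sum_cos_sin_roots_eq0 (R : realType) (N l : nat) : (0 < l < N)%N ->
  \sum_(n < N) cos (2 * n.+1%:R * l%:R * pi / N%:R) = 0 :> R /\
  \sum_(n < N) sin (2 * n.+1%:R * l%:R * pi / N%:R) = 0 :> R.
Proof.
move=> /andP[l0 lN].
have N0 : 0 < N%:R :> R by rewrite ltr0n (leq_ltn_trans _ lN).
pose x : R := 2 * l%:R * pi / N%:R.
have x2 : x / 2 = l%:R * pi / N%:R by rewrite /x; field; rewrite gt_eqF.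
have Nx : N%:R * x = pi *+ 2 *+ l.
  by rewrite -[RHS]mulr_natr -(mulr_natr pi) /x; field; rewrite gt_eqF.
have [|||hc hs] := @sum_cos_sin_eq0 R N x.
(* Since [0 < l < N], the half-angle lies strictly between 0 and [pi]. *)
- rewrite gt_eqF// x2 sin_gt0_pi// divr_gt0 ?mulr_gt0 ?pi_gt0 ?N0 ?ltr0n//=.
  by rewrite ltr_pdivrMr// mulrC ltr_pM2l ?pi_gt0// ltr_nat.
- by rewrite Nx addrC (periodicn (@cosD2pi R)).
- by rewrite Nx addrC (periodicn (@sinD2pi R)).
have xE (n : 'I_N) : 2 * n.+1%:R * l%:R * pi / N%:R = n.+1%:R * x.
  by rewrite /x; ring.
by split; under eq_bigr do rewrite xE.
Qed.

(** * The explicit constant *)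

Theorem corollary2p7 (d : measure_display) (T : measurableType d)
    (R : realType) (P : probability T R) (N l m : nat)
    (B : 'I_N -> {RV P >-> R})
    (N_gt0 : (0 < N)%N) (l_gt0 : (0 < l)%N) (l_le : (l <= N - 1)%N)
    (m_ge1 : (1 <= m)%N) (m_le : (m <= N)%N)
    (B_indep : mutually_independent B)
    (B_ident : identically_distributed B)
    (B_law1 : forall n, P [set w | B n w = 1] = (m%:R / N%:R)%:E)
    (B_law0 : forall n, P [set w | B n w = 0] = (1 - m%:R / N%:R)%:E) :
  (psi2_norm P (Utilde B l) <=
     (Num.sqrt N%:R *
        (Num.sqrt (2 * expR 1) + Num.sqrt (2 * expR 1 + 4)) / 4)%:E)%E /\
  (psi2_norm P (Vtilde B l) <=
     (Num.sqrt N%:R *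
        (Num.sqrt (2 * expR 1) + Num.sqrt (2 * expR 1 + 4)) / 4)%:E)%E.
Proof.
have lN : (0 < l < N)%N by rewrite l_gt0/= -(prednK N_gt0) ltnS -subn1.
have [sum_cos sum_sin] := sum_cos_sin_roots_eq0 R lN.
have N0 : 0 < N%:R :> R by rewrite ltr0n.
have p01 : 0 <= (m%:R / N%:R : R) <= 1.
  by rewrite divr_ge0//= ler_pdivrMr// mul1r ler_nat.
set K := Num.sqrt _ * _ / _.
have e2 : 2 <= expR 1 :> R by have := @expR_ge1Dx R 1; lra.
have s1 : 2 <= Num.sqrt (2 * expR 1) :> R.
  by rewrite -ler_sqr ?nnegrE ?sqrtr_ge0// sqr_sqrtr; lra.
(* [14 / 5] is a rational lower bound for the square root of 8. Then [K ^+ 2] is at least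
   [(24 / 5 / 4) ^+ 2 = 36 / 25] times [N%:R], above the required [4 / 3]. *)
have s2 : 14 / 5 <= Num.sqrt (2 * expR 1 + 4) :> R.
  by rewrite -ler_sqr ?nnegrE ?sqrtr_ge0// sqr_sqrtr; lra.
have sN : 0 < Num.sqrt N%:R :> R by rewrite sqrtr_gt0.
have K0 : 0 < K by rewrite /K divr_gt0// mulr_gt0//; lra.
have NK : 4 / 3 * N%:R <= K ^+ 2.
  rewrite /K !exprMn sqr_sqrtr ?ler0n// [leLHS]mulrC -[leRHS]mulrA ler_pM2l//.
  nra.
split.
  apply: (psi2_norm_bernoulli_sum_le B_indep p01 B_law1 B_law0) => // n.
  exact: cos_max.
(* The outer sign moves into the coefficients, which keep absolute value at most 1 and sum 0. *)
have -> : Vtilde B l =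
    fun w => \sum_(n < N) - sin (2 * n.+1%:R * l%:R * pi / N%:R) * B n w.
  by apply/funext => w; rewrite /Vtilde -sumrN; under eq_bigr do rewrite -mulNr.
apply: (psi2_norm_bernoulli_sum_le B_indep p01 B_law1 B_law0) => //.
  by move=> n; rewrite normrN sin_max.
by rewrite sumrN sum_sin oppr0.
Qed.
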